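(* Let $C$ be a non-empty finite subset of $\mathbb{Z}$. Then ${\rm NI}(C)$ is a Frobenius pseudo-variety. Moreover, $\max({\rm NI}(C))=\mathbb{N}$ if $C\subseteq\{-2,-1\}\cup\mathbb{N}$, and $\max({\rm NI}(C))=\{0\}\cup\{n\in\mathbb{N}: n\ge\theta(C)\}$ otherwise.
   Context: $\mathbb{N}$ denotes the non-negative integers. A numerical semigroup is a submonoid $S$ of $(\mathbb{N},+)$ with $\gcd(S)=1$ (equivalently, $\mathbb{N}\setminus S$ finite). Its Frobenius number ${\rm F}(S)$ is the greatest integer not belonging to $S$ (so ${\rm F}(\mathbb{N})=-1$). For $C\subseteq\mathbb{Z}$, a $C$-incentive is a submonoid $M$ of $(\mathbb{N},+)$ such that $s+t+c\in M$ for all $s,t\in M\setminus\{0\}$ and all $c\in C$; it is numerical if $\gcd(M)=1$. ${\rm NI}(C)$ is the set of all numerical $C$-incentives. $\theta(C)=-\min(C\cup\{0\})$. A Frobenius pseudo-variety is a non-empty family $\mathcal{P}$ of numerical semigroups such that: (1) $\mathcal{P}$ has a maximum element $\max(\mathcal{P})$ with respect to inclusion; (2) if $S,T\in\mathcal{P}$, then $S\cap T\in\mathcal{P}$; (3) if $S\in\mathcal{P}$ and $S\ne\max(\mathcal{P})$, then $S\cup\{{\rm F}(S)\}\in\mathcal{P}$. *)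

(* Defs.v *)
From mathcomp Require Import all_boot all_order all_algebra.
From mathcomp Require Import finmap.
From mathcomp Require Import boolp classical_sets functions cardinality.

Set Implicit Arguments.
Unset Strict Implicit.
Unset Printing Implicit Defensive.

Import Order.TTheory GRing.Theory Num.Theory.

Local Open Scope classical_set_scope.
Local Open Scope ring_scope.

Definition is_submonoid (M : set nat) : Prop :=
  M 0%N /\ forall s t, M s -> M t -> M (s + t)%N.

(* Order for divisibility: in particular [is_gcd [set 0%N] 0]. *)
Definition is_gcd (S : set nat) (g : nat) : Prop :=
  (forall s, S s -> (g %| s)%N) /\
  (forall d, (forall s, S s -> (d %| s)%N) -> (d %| g)%N).

Definition numerical_semigroup (S : set nat) : Prop :=
  is_submonoid S /\ is_gcd S 1.

(* Subsets of the naturals are seen in [int] through [Posz @` _], so negative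
   integers lie in the complement. *)
Definition is_frobenius (S : set nat) (f : int) : Prop :=
  ~ (Posz @` S) f /\ forall z : int, ~ (Posz @` S) z -> z <= f.

(* The default value 0 is irrelevant for numerical semigroups: their
   complement in [int] always has a greatest element. *)
Definition frobenius (S : set nat) : int := xget 0 (is_frobenius S).

Definition is_incentive (C : set int) (M : set nat) : Prop :=
  is_submonoid M /\
  forall s t : nat, M s -> M t -> s <> 0%N -> t <> 0%N ->
  forall c : int, C c -> (Posz @` M) (s%:Z + t%:Z + c).

Definition NI (C : set int) : set (set nat) :=
  [set M | is_incentive C M /\ is_gcd M 1].

(* The initial value 0 of the iterated minimum accounts for the union with {0};
   [fset_set C] enumerates [C] when [C] is finite. *)
Definition theta (C : set int) : int :=
  - \big[Num.min/0]_(c <- fset_set C) c.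

Definition is_maximum (P : set (set nat)) (M : set nat) : Prop :=
  P M /\ forall S, P S -> S `<=` M.

(* In the last clause [S] is properly contained in [M], hence is not the whole
   of [nat], so [frobenius S] is a natural number. *)
Definition frobenius_pseudo_variety (P : set (set nat)) : Prop :=
  [/\ P !=set0,
      P `<=` numerical_semigroup &
      exists M, [/\ is_maximum P M,
        forall S T, P S -> P T -> P (S `&` T) &
        forall S, P S -> S <> M ->
          P (S `|` [set n : nat | n%:Z = frobenius S])]].

(* Main.v *)
Require Import Defs.
From mathcomp Require Import all_boot all_order all_algebra.
From mathcomp Require Import finmap.
From mathcomp Require Import boolp classical_sets functions cardinality.
From mathcomp Require Import zify.

Set Implicit Arguments.
Unset Strict Implicit.
Unset Printing Implicit Defensive.

Import Order.TTheory GRing.Theory Num.Theory.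

Local Open Scope classical_set_scope.
Local Open Scope ring_scope.

(** Write k = theta(C). If C is not contained in {-2, -1} u N then k >= 3 and
    -k is in C. Let m be the least nonzero element of a numerical C-incentive.
    From 2m - k in M and minimality, either m >= k or 2m = k. In the
    second case, adding m and -k shows that M is stable under subtraction of m,
    so all its elements are multiples of m >= 2, contradicting gcd(M) = 1.
    Hence all nonzero elements are at least k. This bound is also what makes
    adjoining the Frobenius number f harmless: f + t + c >= f for t >= k. *)

(** * Numerical semigroups: cofiniteness and Frobenius number *)

Lemma submonoid_mul (S : set nat) (k a : nat) :
  is_submonoid S -> S a -> S (k * a)%N.
Proof.
move=> [S0 SD] Sa; elim: k => [|k IHk]; first by rewrite mul0n.
by rewrite mulSn; exact: SD.
Qed.

(** Every later proof that a set has gcd 1 goes through this criterion. *)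
Lemma consecutive_gcd1 (S : set nat) (n : nat) :
  S n -> S n.+1 -> is_gcd S 1.
Proof.
move=> Sn Sn1; split=> [s _|d dS]; first exact: dvd1n.
by rewrite -(dvdn_addr 1 (dS _ Sn)) addn1 dS.
Qed.

(* The least positive difference of two elements of S divides all of S. *)
Lemma numerical_semigroup_consecutive (S : set nat) :
  numerical_semigroup S -> exists2 a, S a & S a.+1.
Proof.
move=> [Smon [_ S1]]; have [S0 SD] := Smon.
pose D d := exists2 a, S a & S (a + d)%N.
have [[s0 Ss0 s0_gt0]|S_eq0] := pselect (exists2 s, S s & (0 < s)%N); last first.
  (* Without a positive element, 0 divides all of S, so the gcd would be 0. *)
  have: (0 %| 1)%N.
    apply: S1 => s Ss; case: s Ss => // s Ss.
    by case: S_eq0; exists s.+1.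
  by rewrite dvd0n.
have exD : exists d, (0 < d)%N && `[< D d >].
  by exists s0; rewrite s0_gt0; apply/asboolP; exists 0%N.
have [d /andP[d_gt0 /asboolP[a Sa Sad]] d_min] := ex_minnP exD.
suff d1 : (d %| 1)%N.
  exists a => //; move: d1; rewrite dvdn1 => /eqP d1.
  by rewrite -addn1 -d1.
apply: S1 => s Ss; rewrite /dvdn -leqn0 leqNgt.
apply/negP => r_gt0; have := ltn_pmod s d_gt0; rewrite ltnNge => /negP; apply.
apply: d_min; rewrite r_gt0; apply/asboolP.
(* With q = s / d and r = s mod d, q(a + d) + r = qa + s lies in S, so r is itself a difference of
   two elements, smaller than d. *)
exists ((s %/ d) * (a + d))%N; first exact: submonoid_mul.
have -> : ((s %/ d) * (a + d) + s %% d = (s %/ d) * a + s)%N.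
  by rewrite {4}(divn_eq s d) mulnDr addnA.
by apply: SD Ss; exact: submonoid_mul.
Qed.

(** For a, a + 1 in S and n = qa + r, write n = (q - r)a + r(a + 1). This requires r <= q, which
    holds once n >= a^2, since then q >= a > r. *)
Lemma numerical_semigroup_cofinite (S : set nat) :
  numerical_semigroup S -> exists N, forall n, (N <= n)%N -> S n.
Proof.
move=> nsS; have [a Sa Sa1] := numerical_semigroup_consecutive nsS.
have [Smon _] := nsS; have [S0 SD] := Smon.
have [a0|a_gt0] := posnP a.
  by exists 0%N => n _; rewrite -(muln1 n); apply: submonoid_mul; rewrite // -a0.
exists (a * a)%N => n n_ge.
have r_lt := ltn_pmod n a_gt0.
have q_ge : (a <= n %/ a)%N by rewrite leq_divRL.
have -> : n = ((n %/ a - n %% a) * a + n %% a * a.+1)%N.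
  rewrite mulnS addnCA -mulnDl subnK; first by rewrite addnC -divn_eq.
  by rewrite (leq_trans _ q_ge) // ltnW.
by apply: SD; exact: submonoid_mul.
Qed.

Lemma frobenius_nat (S : set nat) :
  numerical_semigroup S -> S <> [set: nat] ->
  exists f : nat, [/\ frobenius S = f%:Z, ~ S f &
    forall n, (f < n)%N -> S n].
Proof.
move=> nsS SNT; have [N SN] := numerical_semigroup_cofinite nsS.
have exS : exists n, `[< ~ S n >].
  apply/not_existsP => allS; apply: SNT; apply/seteqP; split=> // n _.
  by apply/not_notP => /asboolP; exact: allS.
have bndS n : `[< ~ S n >] -> (n <= N)%N.
  by move/asboolP => Sn; case: leqP => // /ltnW /SN.
have [f /asboolP Sf f_max] := ex_maxnP exS bndS.
have gtS n : (f < n)%N -> S n.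
  rewrite ltnNge => /negP fn; apply/not_notP => Sn; apply: fn.
  by apply: f_max; apply/asboolP.
exists f; split=> //.
have frob_f : is_frobenius S f.
  split=> [[n Sn [nf]]|z Sz]; first by apply: Sf; rewrite -nf.
  case: z Sz => [z Sz|//]; rewrite lez_nat leqNgt; apply/negP => /gtS Sz'.
  by apply: Sz; exists z.
rewrite /frobenius; case: xgetP => [g _ [Sg g_max]|/(_ f)] //.
apply/eqP; rewrite eq_le; case: frob_f => Sf' f_max'.
by rewrite (f_max' _ Sg) (g_max _ Sf').
Qed.

(** * Integer-valued membership and bounds by theta *)

Lemma mem_Posz_image (M : set nat) (z : int) :
  (Posz @` M) z <-> 0 <= z /\ M `|z|%N.
Proof.
split=> [[n Mn <-]|[z_ge0 Mz]]; first by split.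
by exists `|z|%N => //; rewrite gez0_abs.
Qed.

Lemma theta_ge (C : set int) (c : int) :
  finite_set C -> C c -> - theta C <= c.
Proof.
move=> C_fin Cc; rewrite /theta opprK.
have : c \in fset_set C by rewrite in_fset_set // inE.
rewrite -[_ \in fset_set C]/(_ \in enum_fset (fset_set C)).
elim: (enum_fset (fset_set C)) => // b s IHs; rewrite big_cons inE.
by rewrite ge_min => /orP[/eqP -> | /IHs ->]; rewrite ?lexx ?orbT.
Qed.

Lemma theta_attained (C : set int) :
  finite_set C -> theta C <> 0 -> C (- theta C).
Proof.
move=> C_fin; rewrite /theta opprK.
have memC c : c \in fset_set C -> C c by rewrite in_fset_set // inE.
move=> th_neq0; apply: memC; move: th_neq0.
rewrite -[_ \in fset_set C]/(_ \in enum_fset (fset_set C)).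
elim: (enum_fset (fset_set C)) => [|b s IHs]; first by rewrite big_nil.
rewrite big_cons inE /Num.min; case: ifP => [|_ th]; first by rewrite eqxx.
by rewrite IHs ?orbT.
Qed.

(** An element of C outside {-2, -1} and N is at most -3, so the iterated minimum drops below its
    initial value 0 and is attained in C. *)
Lemma theta_not_sub (C : set int) :
  finite_set C -> ~ (C `<=` [set -2; -1] `|` range Posz) ->
  exists k : nat, [/\ theta C = k%:Z, (3 <= k)%N, C (- k%:Z) &
    forall c, C c -> - k%:Z <= c].
Proof.
move=> C_fin /existsNP[c /not_implyP[Cc c_notin]].
have c_le : c <= -3.
  rewrite leNgt; apply/negP => c_gt; apply: c_notin.
  have [|c_lt0] := leP 0 c; first by case: c {Cc} c_gt => // n _ _; right; exists n.
  by left; have [->|] := eqVneq c (-2); [left | right => /=; lia].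
have th_ge := theta_ge C_fin Cc.
have thE : theta C = `|theta C|%N by lia.
exists `|theta C|%N; rewrite -thE; split=> //; first by lia.
  by apply: theta_attained => //; lia.
by move=> d; exact: theta_ge.
Qed.

(** * Intersection and adjunction of the Frobenius number *)

Lemma NI_numerical_semigroup (C : set int) : NI C `<=` numerical_semigroup.
Proof. by move=> S [[]]. Qed.

Lemma NI_setI (C : set int) (S T : set nat) :
  NI C S -> NI C T -> NI C (S `&` T).
Proof.
move=> NS NT.
have [M SM] := numerical_semigroup_cofinite (NI_numerical_semigroup NS).
have [N TN] := numerical_semigroup_cofinite (NI_numerical_semigroup NT).
case: NS NT => [[[S0 SD] SC] _] [[[T0 TD] TC] _].
split; last first.
  (* The gcd of an intersection is not controlled by the two gcds alone; cofiniteness puts M + N and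
     its successor in both sets. *)
  by apply: (@consecutive_gcd1 _ (M + N)%N); split; [apply: SM|apply: TN|apply: SM|apply: TN]; lia.
split=> [|s t [Ss Ts] [St Tt] s0 t0 c Cc].
  by split=> // s t [Ss Ts] [St Tt]; split; [exact: SD | exact: TD].
apply/mem_Posz_image.
have /mem_Posz_image[ge0 Sst] := SC s t Ss St s0 t0 c Cc.
by have /mem_Posz_image[_ Tst] := TC s t Ts Tt s0 t0 c Cc.
Qed.

(** All integers from f on lie in the union, which settles plain sums involving f; sums avoiding f
    stay in S. Only f + t + c remains, and its treatment depends on C. *)
Lemma NI_setU_frobenius (C : set int) (S : set nat) (f : nat) :
  NI C S -> ~ S f -> (forall n, (f < n)%N -> S n) ->
  (forall t c, (S `|` [set f]) t -> t <> 0%N -> C c ->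
    (Posz @` (S `|` [set f])) (f%:Z + t%:Z + c)) ->
  NI C (S `|` [set f]).
Proof.
move=> [[[S0 SD] SC] _] Sf gtS fC.
have f_gt0 : (0 < f)%N by case: f Sf {gtS fC}.
have geT n : (f <= n)%N -> (S `|` [set f]) n.
  by rewrite leq_eqVlt => /orP[/eqP <-|/gtS]; [right | left].
split; last by apply: (@consecutive_gcd1 _ f); apply: geT.
split; first split; first by left.
  move=> s t [Ss|->] [St|->]; first by left; exact: SD.
  - by apply: geT; rewrite leq_addl.
  - by apply: geT; rewrite leq_addr.
  - by apply: geT; rewrite leq_addr.
move=> s t Ts Tt s0 t0 c Cc.
have [->|sf] := eqVneq s f; first exact: fC.
have [->|tf] := eqVneq t f; first by rewrite (addrC s%:Z); exact: fC.
case: Ts => [Ss|/eqP]; last by rewrite (negPf sf).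
case: Tt => [St|/eqP]; last by rewrite (negPf tf).
by have [n Sn <-] := SC s t Ss St s0 t0 c Cc; exists n => //; left.
Qed.

(** * The maximum, and adjunction of f, in each of the two cases *)

Lemma maximum_NI_sub (C : set int) :
  C `<=` [set -2; -1] `|` range Posz -> is_maximum (NI C) [set: nat].
Proof.
move=> subC; split=> //; split; last exact: (@consecutive_gcd1 _ 0%N).
split=> // s t _ _ s0 t0 c /subC cC; apply/mem_Posz_image; split=> //.
(* Since s, t >= 1 and c >= -2, the sum s + t + c is non-negative. *)
by case: cC => [[->|->]|[n _ <-]]; lia.
Qed.

Lemma NI_ge_theta (C : set int) (k : nat) (S : set nat) (s : nat) :
  (3 <= k)%N -> C (- k%:Z) -> NI C S -> S s -> s <> 0%N -> (k <= s)%N.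
Proof.
move=> k_ge3 Ck [[_ SC] [_ S1]] Ss s0.
have exS : exists n, (0 < n)%N && `[< S n >].
  by exists s; apply/andP; split; [lia | apply/asboolP].
have [m /andP[m_gt0 /asboolP Sm] m_min] := ex_minnP exS.
have minS n : S n -> n <> 0%N -> (m <= n)%N.
  by move=> Sn n0; apply: m_min; apply/andP; split; [lia | apply/asboolP].
have [km|mk] := leqP k m; first exact: leq_trans km (minS _ Ss s0).
have m_neq0 : m <> 0%N by lia.
have /mem_Posz_image[ge0 Smm] := SC m m Sm Sm m_neq0 m_neq0 _ Ck.
have kE : k = (m + m)%N.
  (* As m < k, a nonzero 2m - k would be an element of S below m. *)
  have [|neq] := eqVneq k (m + m)%N; first by [].
  have neq0 : `|(m%:Z + m%:Z - k%:Z)%R|%N <> 0%N by lia.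
  by have := minS _ Smm neq0; lia.
(* Since k = 2m, m + t - k is t - m. *)
have subm t : S t -> t <> 0%N -> (m <= t)%N /\ S (t - m)%N.
  move=> St t0; have mt := minS _ St t0; split=> //.
  have /mem_Posz_image[_] := SC m t Sm St m_neq0 t0 _ Ck.
  by congr S; lia.
have : (m %| 1)%N.
  apply: S1 => t; elim/ltn_ind: t => t IHt St.
  have [->|/eqP t0] := eqVneq t 0%N; first exact: dvdn0.
  have [mt Stm] := subm t St t0.
  by rewrite -(subnK mt) dvdn_addl // IHt //; lia.
(* m = 1 would give k = 2, against 3 <= k. *)
by rewrite dvdn1 => /eqP m1; lia.
Qed.

Lemma maximum_NI_not_sub (C : set int) :
  finite_set C -> ~ (C `<=` [set -2; -1] `|` range Posz) ->
  is_maximum (NI C) ([set 0%N] `|` [set n : nat | theta C <= n%:Z]).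
Proof.
move=> C_fin /(theta_not_sub C_fin)[k [-> k_ge3 Ck minC]]; split; last first.
  move=> S NS s Ss; have [->|/eqP s0] := eqVneq s 0%N; [by left | right].
  by rewrite /= lez_nat; exact: NI_ge_theta Ck NS Ss s0.
split; last by apply: (@consecutive_gcd1 _ k); right => /=; lia.
split; first split; first by left.
  move=> s t [->|/= ks] [->|/= kt]; [by left | right => /=; lia ..].
(* From s, t >= k and c >= -k follows s + t + c >= k. *)
move=> s t [->|/= ks] // [->|/= kt] // _ _ c /minC kc.
by apply/mem_Posz_image; split; [lia | right => /=; lia].
Qed.

(** As c >= -2, f + t + c >= f as soon as t >= 2. If f = 1 the union is all of N and 1 + 1 - 2 = 0
    suffices; if f > 1, then t = 1 would put 1, hence f, in S. *)
Lemma NI_setU_frobenius_sub (C : set int) (S : set nat) (f : nat) :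
  C `<=` [set -2; -1] `|` range Posz ->
  NI C S -> ~ S f -> (forall n, (f < n)%N -> S n) ->
  NI C (S `|` [set f]).
Proof.
move=> subC NS Sf gtS; apply: NI_setU_frobenius => // t c Tt t0 Cc.
have [[Smon _] _] := NS.
have f0 : f <> 0%N by move=> f0; apply: Sf; rewrite f0; case: Smon.
have c_ge : -2 <= c by case: (subC _ Cc) => [[->|->]|[n _ <-]].
have geT n : (f <= n)%N -> (S `|` [set f]) n.
  by rewrite leq_eqVlt => /orP[/eqP <-|/gtS]; [right | left].
have [f1|f_neq1] := eqVneq f 1%N.
  apply/mem_Posz_image; split; first by lia.
  by case: `|_|%N => [|n]; [left; case: Smon | apply: geT; lia].
have t_neq1 : t <> 1%N.
  move=> t1; apply: Sf; rewrite -(muln1 f); apply: submonoid_mul => //.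
  by case: Tt => [|/= tf]; [rewrite t1 | lia].
have t_gt1 : (1 < t)%N by lia.
by apply/mem_Posz_image; split; [lia | apply: geT; lia].
Qed.

Lemma NI_setU_frobenius_not_sub (C : set int) (S : set nat) (f : nat) :
  finite_set C -> ~ (C `<=` [set -2; -1] `|` range Posz) ->
  S <> [set 0%N] `|` [set n : nat | theta C <= n%:Z] ->
  NI C S -> ~ S f -> (forall n, (f < n)%N -> S n) ->
  NI C (S `|` [set f]).
Proof.
move=> C_fin /(theta_not_sub C_fin)[k [-> k_ge3 Ck minC]] SNM NS Sf gtS.
(* If f < k, then S contains every integer from k on and no smaller nonzero one, so S is already the
   maximum. The bound covers the case t = f below. *)
have kf : (k <= f)%N.
  rewrite leqNgt; apply/negP => fk; apply: SNM.
  apply/seteqP; split=> [s Ss|s [->|/= ks]].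
  - have [->|/eqP s0] := eqVneq s 0%N; [by left | right].
    by rewrite /= lez_nat; exact: NI_ge_theta Ck NS Ss s0.
  - by case: NS => [[[]]].
  - by apply: gtS; lia.
apply: NI_setU_frobenius => // t c Tt t0 /minC kc.
have kt : (k <= t)%N.
  by case: Tt => [St|->] //; exact: NI_ge_theta Ck NS St t0.
apply/mem_Posz_image; split; first by lia.
set n := `|_|%N; have : (f <= n)%N by lia.
by rewrite leq_eqVlt => /orP[/eqP <-|/gtS]; [right | left].
Qed.

Lemma frobenius_pseudo_variety_NI (C : set int) (M : set nat) :
  is_maximum (NI C) M ->
  (forall S f, S <> M -> NI C S -> ~ S f -> (forall n, (f < n)%N -> S n) ->
    NI C (S `|` [set f])) ->
  frobenius_pseudo_variety (NI C).
Proof.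
move=> maxM addf; split; first by exists M; case: maxM.
  exact: NI_numerical_semigroup.
exists M; split=> // [S T|S NS SNM]; first exact: NI_setI.
(* S = N would force S = M, because S is contained in M. *)
have SNT : S <> [set: nat].
  move=> ST; apply: SNM; apply/seteqP; split; first by case: maxM => _; apply.
  by rewrite ST.
have [f [-> Sf gtS]] := frobenius_nat (NI_numerical_semigroup NS) SNT.
have -> : [set n : nat | n%:Z = f%:Z] = [set f].
  by apply/seteqP; split=> n /=; lia.
exact: addf.
Qed.

Theorem theorem5p5 (C : set int) (C_fin : finite_set C) (C_neq0 : C !=set0) :
  [/\ frobenius_pseudo_variety (NI C),
      C `<=` [set -2; -1] `|` range Posz -> is_maximum (NI C) [set: nat] &
      ~ (C `<=` [set -2; -1] `|` range Posz) ->
        is_maximum (NI C) ([set 0%N] `|` [set n : nat | theta C <= n%:Z])].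
Proof.
split; [|exact: maximum_NI_sub|exact: maximum_NI_not_sub].
have [subC|subC] := pselect (C `<=` [set -2; -1] `|` range Posz).
  apply: frobenius_pseudo_variety_NI (maximum_NI_sub subC) _ => S f _.
  exact: NI_setU_frobenius_sub.
apply: frobenius_pseudo_variety_NI (maximum_NI_not_sub C_fin subC) _ => S f.
exact: NI_setU_frobenius_not_sub.
Qed.
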